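(* Let $G$ and $H$ be graphs with $\mathrm{oh}(G)=s$ and $\mathrm{oh}(H)=t$. Then $\mathrm{oh}(G \ast H) \geq \mathrm{oh}(K_s \ast K_t)$, where $\ast$ is any one of the Cartesian product $\square$, the lexicographic product, or the strong product $\boxtimes$.
   Context: All graphs are finite, simple and loopless. For graphs $G$ and $H$, the Odd Hadwiger number $\mathrm{oh}(G)$ is the largest integer $m$ such that $G$ contains $K_m$ as an odd minor; equivalently, the largest $m$ for which there exist $m$ pairwise vertex-disjoint trees $Z_1,\dots,Z_m$ (subgraphs of $G$) and a 2-colouring $c$ of $V(Z_1)\cup\dots\cup V(Z_m)$ such that $c$ is a proper colouring of each $Z_k$, and for every pair $k\neq k'$ there is an edge $xy\in E(G)$ with $x\in V(Z_k)$, $y\in V(Z_{k'})$ and $c(x)=c(y)$. Products all have vertex set $V(G)\times V(H)$. Cartesian product $G\square H$: $(v_1,u_1)\sim(v_2,u_2)$ iff ($v_1=v_2$ and $u_1u_2\in E(H)$) or ($u_1=u_2$ and $v_1v_2\in E(G)$). Lexicographic product: $(v_1,u_1)\sim(v_2,u_2)$ iff $v_1v_2\in E(G)$, or ($v_1=v_2$ and $u_1u_2\in E(H)$). Strong product $G\boxtimes H$: $(v_1,u_1)\sim(v_2,u_2)$ iff they are adjacent in $G\square H$ or ($v_1v_2\in E(G)$ and $u_1u_2\in E(H)$). *)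

(* Defs.v *)
From mathcomp Require Import all_boot.

Set Implicit Arguments.
Unset Strict Implicit.
Unset Printing Implicit Defensive.

Record sgraph := SGraph {
  vertex :> finType;
  adj : rel vertex;
  adj_sym : symmetric adj;
  adj_irr : irreflexive adj
}.

Definition complete_rel (n : nat) : rel 'I_n := fun i j => i != j.

Lemma complete_sym n : symmetric (@complete_rel n).
Proof. by move=> i j; rewrite /complete_rel eq_sym. Qed.

Lemma complete_irr n : irreflexive (@complete_rel n).
Proof. by move=> i; rewrite /complete_rel eqxx. Qed.

Definition complete (n : nat) : sgraph :=
  SGraph (@complete_sym n) (@complete_irr n).

Section Products.
Variables G H : sgraph.

Definition cartesian_rel : rel (G * H)%type := fun p q =>
  ((p.1 == q.1) && adj p.2 q.2) || ((p.2 == q.2) && adj p.1 q.1).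

Definition lexicographic_rel : rel (G * H)%type := fun p q =>
  adj p.1 q.1 || ((p.1 == q.1) && adj p.2 q.2).

Definition strong_rel : rel (G * H)%type := fun p q =>
  cartesian_rel p q || (adj p.1 q.1 && adj p.2 q.2).

Lemma cartesian_sym : symmetric cartesian_rel.
Proof.
move=> p q; rewrite /cartesian_rel (eq_sym p.1) (eq_sym p.2).
by rewrite (adj_sym p.1) (adj_sym p.2).
Qed.

Lemma cartesian_irr : irreflexive cartesian_rel.
Proof. by move=> p; rewrite /cartesian_rel !adj_irr !andbF. Qed.

Lemma lexicographic_sym : symmetric lexicographic_rel.
Proof.
move=> p q; rewrite /lexicographic_rel (eq_sym p.1).
by rewrite (adj_sym p.1) (adj_sym p.2).
Qed.

Lemma lexicographic_irr : irreflexive lexicographic_rel.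
Proof. by move=> p; rewrite /lexicographic_rel !adj_irr andbF. Qed.

Lemma strong_sym : symmetric strong_rel.
Proof.
move=> p q; rewrite /strong_rel cartesian_sym.
by rewrite (adj_sym p.1) (adj_sym p.2).
Qed.

Lemma strong_irr : irreflexive strong_rel.
Proof. by move=> p; rewrite /strong_rel cartesian_irr adj_irr. Qed.

Definition cartesian : sgraph := SGraph cartesian_sym cartesian_irr.
Definition lexicographic : sgraph := SGraph lexicographic_sym lexicographic_irr.
Definition strong : sgraph := SGraph strong_sym strong_irr.

End Products.

Section OddHadwiger.
Variable G : sgraph.

(* A candidate subgraph is a vertex set together with a set of ordered pairs;
   [is_subgraph] requires each edge to be present in both orientations. *)
Definition subgraph : Type := ({set G} * {set G * G})%type.

Implicit Type Z : subgraph.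

Definition sub_verts Z : {set G} := Z.1.
Definition sub_adj Z : rel G := fun x y => (x, y) \in Z.2.

Definition is_subgraph Z : bool :=
  [forall x, forall y, sub_adj Z x y ==>
    [&& x \in sub_verts Z, y \in sub_verts Z, adj x y & sub_adj Z y x]].

Definition connected Z : bool :=
  (sub_verts Z != set0) &&
  [forall x in sub_verts Z, forall y in sub_verts Z, connect (sub_adj Z) x y].

(* A cycle has pairwise distinct vertices, so bounding its length by [#|G|]
   loses nothing; see [acyclicP]. *)
Definition acyclic Z : bool :=
  [forall n : 'I_#|G|.+1, forall p : n.-tuple G,
    (2 < n) ==> ~~ ucycleb (sub_adj Z) p].

Definition is_tree Z : bool := [&& is_subgraph Z, connected Z & acyclic Z].

(* Only the values of [c] on the union of the trees matter. *)
Definition odd_clique_model (m : nat) (Z : {ffun 'I_m -> subgraph})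
    (c : {ffun G -> bool}) : bool :=
  [&& [forall k, is_tree (Z k)],
      [forall k, forall k', (k != k') ==>
         [disjoint sub_verts (Z k) & sub_verts (Z k')]],
      [forall k, forall x, forall y, sub_adj (Z k) x y ==> (c x != c y)]
    & [forall k, forall k', (k != k') ==>
         [exists x in sub_verts (Z k), exists y in sub_verts (Z k'),
            adj x y && (c x == c y)]]].

Definition has_odd_clique_minor (m : nat) : bool :=
  [exists Z : {ffun 'I_m -> subgraph}, exists c : {ffun G -> bool},
     odd_clique_model Z c].

(* The bound [m <= #|G|] loses nothing, since the trees are nonempty and
   disjoint; see [oh_max]. *)
Definition oh : nat := \max_(m < #|G|.+1 | has_odd_clique_minor m) m.

Lemma acyclicP Z :
  reflect (forall p : seq G, 2 < size p -> ~ ucycle (sub_adj Z) p) (acyclic Z).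
Proof.
apply: (iffP forallP) => [acZ p p_gt2 cyc_p | acZ n].
  have p_le : size p < #|G|.+1.
    by rewrite ltnS; case/andP: cyc_p => _ /card_uniqP <-; apply: max_card.
  have /forallP/(_ (in_tuple p))/implyP/(_ p_gt2)/negP := acZ (Ordinal p_le).
  by apply.
apply/forallP=> p; apply/implyP=> n_gt2; apply/negP.
by apply: acZ; rewrite size_tuple.
Qed.

Lemma has_odd_clique_minor_le m : has_odd_clique_minor m -> m <= #|G|.
Proof.
case/existsP=> Z /existsP[c /and4P[treeZ disjZ _ _]].
have Z_n0 k : exists x, x \in sub_verts (Z k).
  by move/forallP/(_ k): treeZ => /and3P[_ /andP[/set0Pn]].
pose f k := xchoose (Z_n0 k).
suff inj_f : injective f by rewrite -[m]card_ord; apply: leq_card inj_f.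
move=> k k' eq_f; apply/eqP; apply: contraT => ne_k.
move/forallP/(_ k)/forallP/(_ k')/implyP/(_ ne_k): disjZ.
move=> /disjointFr/(_ (xchooseP (Z_n0 k))).
by rewrite -/(f k) eq_f (xchooseP (Z_n0 k')).
Qed.

Lemma has_odd_clique_minor0 : has_odd_clique_minor 0.
Proof.
apply/existsP; exists [ffun=> (set0, set0)]; apply/existsP; exists [ffun=> true].
by apply/and4P; split; apply/forallP=> -[].
Qed.

Lemma oh_max m : has_odd_clique_minor m -> m <= oh.
Proof.
move=> mG; have m_le : m < #|G|.+1 by rewrite ltnS has_odd_clique_minor_le.
exact: (@leq_bigmax_cond _ _ (fun i : 'I_#|G|.+1 => i : nat) (Ordinal m_le)).
Qed.

Lemma oh_has_odd_clique_minor : has_odd_clique_minor oh.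
Proof.
rewrite /oh; elim/big_ind: _ => //; first exact: has_odd_clique_minor0.
by move=> a b Ha Hb; rewrite /maxn; case: ifP.
Qed.

End OddHadwiger.

(* Main.v *)
(* Odd minors compose, so it suffices that [K_s * K_t] is an odd minor of
   [G * H].  If [A_i] (with colouring [a]) and [B_j] (with colouring [b]) are the
   branch sets in [G] and [H], take the branch sets [A_i x B_j] with the colouring
   [a + b] modulo 2.  Cartesian edges already connect each [A_i x B_j] by
   bichromatic edges.  Monochromatic edges [x x'] between [A_i] and [A_i'] and
   [y y'] between [B_j] and [B_j'] yield a pair [(x, y)], [(x', y')] of equal
   colour; choosing [x = x'] when [i = i'] and [y = y'] when [j = j'], this pair
   has the same adjacency pattern as [(i, j)], [(i', j')] has in [K_s * K_t]. *)
Require Import Defs.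
From mathcomp Require Import all_boot.

Set Implicit Arguments.
Unset Strict Implicit.
Unset Printing Implicit Defensive.

Lemma connect_homo (T U : finType) (e : rel T) (e' : rel U) (f : T -> U) :
  {homo f : x y / e x y >-> connect e' x y} ->
  {homo f : x y / connect e x y >-> connect e' x y}.
Proof.
move=> f_homo x _ /connectP[p e_p ->].
elim: p x e_p => //= y p IHp x /andP[/f_homo xy /IHp]; exact: connect_trans.
Qed.

Section SpanningTree.
Variables (G : sgraph) (e : rel G) (B : {set G}) (r : G).
Hypotheses (e_sym : symmetric e) (eB : forall x y, e x y -> x \in B).
Hypothesis conn_r : forall x, x \in B -> connect e r x.

(** On [B], [d] is the distance from [r] along [e], and [p x] precedes [x] on a shortest walk from
    [r]. *)
Lemma parent_exists : exists (d : G -> nat) (p : G -> G),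
  forall x, x \in B -> x != r -> e x (p x) /\ d (p x) < d x.
Proof.
pose reach n x := [exists q : n.-tuple G, path e r q && (last r q == x)].
have reachP q : path e r q -> reach (size q) (last r q).
  by move=> e_q; apply/existsP; exists (in_tuple q); rewrite e_q eqxx.
(* Outside [B] the implication holds at 0, which makes [d] a total function. *)
have reach_ex x : exists n, (x \in B) ==> reach n x.
  have [/conn_r/connectP[q /reachP e_q ->]|_] := boolP (x \in B); last by exists 0.
  by exists (size q); rewrite e_q implybT.
pose d x := ex_minn (reach_ex x); exists d.
apply: (@fin_all_exists _ _ (fun x y =>
  x \in B -> x != r -> e x y /\ d y < d x)) => x.
have [xB|_] := boolP (x \in B); last by exists x.
have [->|x_r] := eqVneq x r; first by exists r.
have : reach (d x) x by rewrite /d; case: ex_minnP => n; rewrite xB.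
case/existsP=> -[q /= /eqP q_size] /andP[e_q /eqP q_x].
case/lastP: q => [|q z] in q_size e_q q_x; first by rewrite -q_x eqxx in x_r.
move: q_x e_q q_size; rewrite last_rcons rcons_path size_rcons => -> /andP[e_q e_x] <-.
exists (last r q) => _ _; split; first by rewrite e_sym.
rewrite ltnS /d; case: ex_minnP => n _; apply.
by rewrite reachP // implybT.
Qed.

(** The tree joins each vertex of [B] other than [r] to its parent. Passing to the parent lowers
    [d], so repeating it leads to [r]; hence connectedness. *)
Lemma spanning_tree (rB : r \in B) (e_adj : subrel e (@adj G)) :
  exists E : {set G * G}, is_tree (B, E) /\ subrel (sub_adj (B, E)) e.
Proof.
have [d [p pP]] := parent_exists.
pose child x y := [&& x \in B, x != r & y == p x].
have childP x y : child x y -> [/\ x \in B, y = p x, e x y & d y < d x].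
  by case/and3P=> xB x_r /eqP->; have [] := pP x xB x_r.
pose E := [set u : G * G | child u.1 u.2 || child u.2 u.1].
have E_adj x y : sub_adj (B, E) x y = child x y || child y x.
  by rewrite /sub_adj inE.
have E_sym : symmetric (sub_adj (B, E)) by move=> x y; rewrite !E_adj orbC.
have E_e : subrel (sub_adj (B, E)) e.
  by move=> x y; rewrite E_adj => /orP[]/childP[] // _ _; rewrite e_sym.
exists E; split=> //; apply/and3P; split.
- apply/forallP=> x; apply/forallP=> y; apply/implyP=> xy.
  have yx : sub_adj (B, E) y x by rewrite E_sym.
  apply/and4P; split=> //; last exact/e_adj/E_e.
    exact: eB (E_e _ _ xy).
  exact: eB (E_e _ _ yx).
- apply/andP; split; first by apply/set0Pn; exists r.
  suff to_r x : x \in B -> connect (sub_adj (B, E)) x r.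
    apply/forall_inP=> x xB; apply/forall_inP=> y yB.
    apply: connect_trans (to_r x xB) _.
    by rewrite (sym_connect_sym E_sym); apply: to_r.
  have [n] := ubnP (d x); elim: n x => // n IHn x; rewrite ltnS => d_n xB.
  have [->|x_r] := eqVneq x r; first exact: connect0.
  have [e_x d_x] := pP x xB x_r.
  apply: connect_trans (connect1 _) (IHn (p x) _ _).
  + by rewrite E_adj /child xB x_r eqxx.
  + exact: leq_trans d_x d_n.
  + by rewrite e_sym in e_x; apply: eB e_x.
(* On a cycle, both neighbours of a vertex of maximal depth are its parent. *)
apply/acyclicP=> c c_gt2 /andP[cyc_c uniq_c].
case: c => [//|x0 c0] in c_gt2 cyc_c uniq_c *; set c := x0 :: c0 in c_gt2 cyc_c uniq_c.
have x0c : x0 \in c by rewrite mem_head.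
case: (@arg_maxnP _ x0 (mem c) d x0c) => v vc v_max.
case/rot_to: (vc) => i c' rot_c.
move: cyc_c uniq_c c_gt2; rewrite -(rot_cycle i) -(rot_uniq i) -(size_rot i) rot_c.
have up w : w \in c -> sub_adj (B, E) v w -> w = p v.
  move=> wc; rewrite E_adj => /orP[/childP[]//|/childP[_ _ _]].
  by rewrite ltnNge [_ <= _](v_max w wc).
have sub_c w : w \in c' -> w \in c.
  by move=> wc; rewrite -(mem_rot i) rot_c inE wc orbT.
(* The cycle now starts at [v] and has length above 2, so its second entry [w] and its last entry
   [z] occupy different positions. *)
case: c' => [|w c'] //= in rot_c sub_c *; case/lastP: c' => [|c' z] // in rot_c sub_c *.
rewrite rcons_path last_rcons => /andP[vw /andP[_ zv]] /and3P[_ w_c' _] _.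
have zc : z \in rcons c' z by rewrite mem_rcons mem_head.
have w_p : w = p v by apply: up vw; apply: sub_c; rewrite mem_head.
have z_p : z = p v by apply: up; [apply: sub_c; rewrite inE zc orbT | rewrite E_sym].
by rewrite w_p -z_p zc in w_c'.
Qed.

End SpanningTree.

Definition bichromatic (G : sgraph) (c : G -> bool) (B : {set G}) : rel G :=
  fun x y => [&& x \in B, y \in B, adj x y & c x != c y].

(* By [spanning_tree], asking that the bichromatic edges connect a branch set
   amounts to asking for a properly coloured spanning tree of it. *)
Definition odd_model (K G : sgraph) (B : K -> {set G}) (c : G -> bool) : Prop :=
  [/\ forall k, B k != set0,
      forall k, {in B k &, forall x y, connect (bichromatic c (B k)) x y},
      forall k k' x, x \in B k -> x \in B k' -> k = k'
    & forall k k', adj k k' -> exists x y,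
        [/\ x \in B k, y \in B k', adj x y & c x = c y]].

Definition odd_minor (K G : sgraph) : Prop :=
  exists (B : K -> {set G}) (c : G -> bool), odd_model B c.

Lemma bichromatic_sym (G : sgraph) (c : G -> bool) B : symmetric (bichromatic c B).
Proof.
by move=> x y; rewrite /bichromatic andbCA adj_sym [c x == _]eq_sym.
Qed.

(** Only equality of colours matters, so flipping the colours on a whole branch set keeps its
    bichromatic edges. *)
Lemma bichromatic_sub (G : sgraph) (c c' : G -> bool) (A B : {set G}) :
  A \subset B -> {in A &, forall x y, (c x == c y) = (c' x == c' y)} ->
  subrel (bichromatic c A) (bichromatic c' B).
Proof.
move=> /subsetP sAB cc' x y /and4P[xA yA xy c_xy].
by rewrite /bichromatic !sAB // xy -cc'.
Qed.

(** Tree edges are bichromatic, so they connect the branch sets as required. Conversely, a spanning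
    tree made of bichromatic edges is properly coloured. *)
Lemma odd_clique_minorP (G : sgraph) m :
  has_odd_clique_minor G m <-> odd_minor (complete m) G.
Proof.
split.
  case/existsP=> Z /existsP[c /and4P[/forallP treeZ /forallP disjZ]].
  move=> /forallP colZ /forallP adjZ.
  exists (fun k => sub_verts (Z k)), c; split=> [k|k x y xZ yZ|k k' x xk xk'|k k' kk'].
  - by case/and3P: (treeZ k) => _ /andP[].
  - have /and3P[/forallP subZ /andP[_ /forall_inP Z_conn] _] := treeZ k.
    apply: connect_sub (forall_inP (Z_conn x xZ) y yZ) => u v uv; apply: connect1.
    have /and4P[uZ vZ a_uv _] := implyP (forallP (subZ u) v) uv.
    rewrite /bichromatic uZ vZ a_uv /=.
    exact: implyP (forallP (forallP (colZ k) u) v) uv.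
  - apply/eqP; apply: contraT => kk'.
    have := implyP (forallP (disjZ k) k') kk'.
    by move=> /disjointFr/(_ xk); rewrite xk'.
  - have /exists_inP[x xk /exists_inP[y yk /andP[xy /eqP c_xy]]] :=
      implyP (forallP (adjZ k) k') kk'.
    by exists x, y.
case=> B [c [B_n0 B_conn B_disj B_adj]].
have trees k : exists E : {set G * G},
    is_tree (B k, E) /\ subrel (sub_adj (B k, E)) (bichromatic c (B k)).
  have /set0Pn[r rB] := B_n0 k.
  apply: (@spanning_tree _ _ _ r) => //.
  - exact: bichromatic_sym.
  - by move=> x y /and4P[].
  - by move=> x xB; apply: B_conn.
  - by move=> x y /and4P[].
have [E EP] := fin_all_exists trees.
apply/existsP; exists [ffun k => (B k, E k)]; apply/existsP; exists [ffun x => c x].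
apply/and4P; split; apply/forallP=> k.
- by rewrite ffunE; case: (EP k).
- apply/forallP=> k'; apply/implyP=> kk'; rewrite !ffunE.
  apply/pred0Pn=> -[x /andP[/= xk xk']].
  by rewrite (B_disj _ _ _ xk xk') eqxx in kk'.
- apply/forallP=> x; apply/forallP=> y; apply/implyP; rewrite !ffunE => xy.
  by have [_ /(_ _ _ xy)/and4P[]] := EP k.
- apply/forallP=> k'; apply/implyP=> kk'; rewrite !ffunE.
  have [x [y [xk yk' xy c_xy]]] := B_adj k k' kk'.
  apply/exists_inP; exists x => //; apply/exists_inP; exists y => //.
  by rewrite xy !ffunE c_xy /=.
Qed.

(** Unite the sets [B k] over [k] in [W l], and flip [c] on [B k] exactly when [w k] holds. An edge
    of [G] realising an edge of [K] is monochromatic for [c], so after the flips it is bichromatic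
    exactly when the edge of [K] is so for [w]. *)
Lemma odd_minor_trans (L K G : sgraph) :
  odd_minor L K -> odd_minor K G -> odd_minor L G.
Proof.
case=> W [w [W_n0 W_conn W_disj W_adj]] [B [c [B_n0 B_conn B_disj B_adj]]].
pose U l := \bigcup_(k in W l) B k.
pose h x := [exists k, (x \in B k) && w k].
have hE k x : x \in B k -> h x = w k.
  move=> xk; apply/existsP/idP=> [[k' /andP[xk']]|wk].
    by rewrite (B_disj _ _ _ xk xk').
  by exists k; rewrite xk.
pose g x := c x (+) h x.
have g_conn l k x y : k \in W l -> x \in B k -> y \in B k ->
    connect (bichromatic g (U l)) x y.
  move=> kW xk yk; apply: connect_sub (B_conn k x y xk yk) => u v uv.
  apply/connect1/(bichromatic_sub _ _ uv); first exact: bigcup_sup.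
  by move=> {}u {}v {uv} uk vk; rewrite /g !(hE k) // (inj_eq (@addIb _)).
exists U, g; split=> [l|l x y /bigcupP[k kW xk] /bigcupP[k' k'W yk']|l l' x|l l' ll'].
- have /set0Pn[k kW] := W_n0 l; have /set0Pn[x xk] := B_n0 k.
  by apply/set0Pn; exists x; apply/bigcupP; exists k.
(* Follow a bichromatic path of [K]: move inside [B k] to [u], then cross into [B k1] by the edge
   realising [k k1]. *)
- have /connectP[q] := W_conn l k k' kW k'W.
  elim: q k x kW xk => [|k1 q IHq] k x kW xk /= => [_ def_k'|].
    by rewrite def_k' in yk'; apply: g_conn kW xk yk'.
  case/andP=> /and4P[_ k1W kk1 w_kk1] /IHq{}IHq /IHq{}IHq.
  have [u [v [uk vk1 uv c_uv]]] := B_adj k k1 kk1.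
  apply: connect_trans (g_conn l k x u kW xk uk) _.
  apply: connect_trans (connect1 _) (IHq v k1W vk1).
  apply/and4P; split=> //; first by apply/bigcupP; exists k.
    by apply/bigcupP; exists k1.
  by rewrite /g (hE k u) // (hE k1 v) // c_uv (inj_eq (@addbI _)).
- case/bigcupP=> k kW xk /bigcupP[k' k'W xk'].
  by apply: W_disj kW _; rewrite (B_disj _ _ _ xk xk').
- have [k [k' [kW k'W kk' w_kk']]] := W_adj l l' ll'.
  have [x [y [xk yk' xy c_xy]]] := B_adj k k' kk'.
  exists x, y; split=> //.
  + by apply/bigcupP; exists k.
  + by apply/bigcupP; exists k'.
  + by rewrite /g (hE k x) // (hE k' y) // c_xy w_kk'.
Qed.

(* The Cartesian, lexicographic and strong products are all of this form. *)
Definition product_rel (f : bool -> bool -> bool -> bool -> bool) (G H : sgraph) :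
  rel (G * H)%type :=
  fun p q => f (p.1 == q.1) (adj p.1 q.1) (p.2 == q.2) (adj p.2 q.2).

Lemma odd_model_complete (s : nat) (G : sgraph) (B : complete s -> {set G}) c :
  odd_model B c -> forall i i', exists x x',
  [/\ x \in B i, x' \in B i', c x = c x',
      (x == x') = (i == i') & adj x x' = adj i i'].
Proof.
case=> B_n0 _ B_disj B_adj i i'; have [<-|ii'] := eqVneq i i'.
  by have /set0Pn[x xi] := B_n0 i; exists x, x; rewrite !adj_irr eqxx.
(* By conversion, [ii'] is the adjacency of [i] and [i'] in [complete s]. *)
have [x [y [xi yi' xy c_xy]]] := B_adj i i' ii'.
exists x, y; split=> //; last by rewrite xy; apply/esym.
by apply: contraNF ii' => /eqP def_y; rewrite (B_disj i i' x) // def_y.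
Qed.

(** The two conditions on [f] say that the product contains the Cartesian edges. Along these one
    summand of the colour is constant, so bichromatic paths in either factor lift to the product. *)
Lemma odd_minor_product f (G H : sgraph) (s t : nat)
    (f_sym : symmetric (@product_rel f G H))
    (f_irr : irreflexive (@product_rel f G H))
    (fK_sym : symmetric (@product_rel f (complete s) (complete t)))
    (fK_irr : irreflexive (@product_rel f (complete s) (complete t))) :
  f true false false true -> f false true true false ->
  odd_minor (complete s) G -> odd_minor (complete t) H ->
  odd_minor (SGraph fK_sym fK_irr) (SGraph f_sym f_irr).
Proof.
move=> f1 f2 [A [a mA]] [B [b mB]].
have adjF (K : sgraph) (x y : K) : adj x y -> (x == y) = false.
  by apply: contraTF => /eqP->; rewrite adj_irr.
have [A_n0 A_conn A_disj _] := mA; have [B_n0 B_conn B_disj _] := mB.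
pose P : sgraph := SGraph f_sym f_irr.
pose C (k : SGraph fK_sym fK_irr) : {set P} := setX (A k.1) (B k.2).
pose c (p : P) := a p.1 (+) b p.2.
exists C, c; split=> [[i j]|[i j] [x y] [x' y']|[i j] [i' j'] [x y]|[i j] [i' j'] kk'].
- have /set0Pn[x xi] := A_n0 i; have /set0Pn[y yj] := B_n0 j.
  by apply/set0Pn; exists (x, y); rewrite inE xi.
- rewrite !inE /= => /andP[xi yj] /andP[xi' yj'].
  apply: (@connect_trans _ _ (x', y)).
    apply: (connect_homo (f := fun u => (u, y) : P)) (A_conn i x x' xi xi').
    move=> u v /and4P[ui vi uv a_uv]; apply: connect1.
    rewrite /bichromatic !inE /= ui vi yj /product_rel /= eqxx uv adj_irr adjF //.
    by rewrite f2 /c /= (inj_eq (@addIb _)).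
  apply: (connect_homo (f := fun u => (x', u) : P)) (B_conn j y y' yj yj').
  move=> u v /and4P[uj vj uv b_uv]; apply: connect1.
  rewrite /bichromatic !inE /= uj vj xi' /product_rel /= eqxx uv adj_irr adjF //.
  by rewrite f1 /c /= (inj_eq (@addbI _)).
- rewrite !inE /= => /andP[xi yj] /andP[xi' yj'].
  by rewrite (A_disj _ _ _ xi xi') (B_disj _ _ _ yj yj').
- have [x [x' [xi xi' a_xx' eq_x adj_x]]] := odd_model_complete mA i i'.
  have [y [y' [yj yj' b_yy' eq_y adj_y]]] := odd_model_complete mB j j'.
  exists (x, y), (x', y'); rewrite !inE /= xi yj xi' yj'; split=> //.
    by rewrite /product_rel /= eq_x adj_x eq_y adj_y.
  by rewrite /c /= a_xx' b_yy'.
Qed.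

Lemma odd_minor_oh (K G : sgraph) : odd_minor K G -> oh K <= oh G.
Proof.
move=> KG; apply/oh_max/odd_clique_minorP/(odd_minor_trans _ KG).
exact/odd_clique_minorP/oh_has_odd_clique_minor.
Qed.

Theorem theorem1 (G H : sgraph) (s t : nat) (hs : oh G = s) (ht : oh H = t) :
  [/\ oh (cartesian (complete s) (complete t)) <= oh (cartesian G H),
      oh (lexicographic (complete s) (complete t)) <= oh (lexicographic G H)
    & oh (strong (complete s) (complete t)) <= oh (strong G H)].
Proof.
have sG : odd_minor (complete s) G.
  by apply/odd_clique_minorP; rewrite -hs; apply: oh_has_odd_clique_minor.
have tH : odd_minor (complete t) H.
  by apply/odd_clique_minorP; rewrite -ht; apply: oh_has_odd_clique_minor.
(* Each product relation is convertible to [product_rel] of the function supplied below; [fC] is the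
   Cartesian rule. *)
pose fC (e1 a1 e2 a2 : bool) := e1 && a2 || e2 && a1.
split; apply: odd_minor_oh.
- exact: (@odd_minor_product fC).
- exact: (@odd_minor_product (fun e1 a1 _ a2 => a1 || e1 && a2)).
- exact: (@odd_minor_product (fun e1 a1 e2 a2 => fC e1 a1 e2 a2 || a1 && a2)).
Qed.
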